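(* Let $m,n\ge 1$ and consider two rows of boxes labeled $A_1,\dots,A_m$ and $B_1,\dots,B_n$, each box with its own key. Suppose that the key to $A_1$ is kept in hand, and that the keys to $A_2,\dots,A_m$ and $B_1,\dots,B_n$ are placed independently, each according to the uniform distribution on the boxes of the opposite row (the keys to $A_2,\dots,A_m$ each uniformly in one of the boxes $B_1,\dots,B_n$, and the keys to $B_1,\dots,B_n$ each uniformly in one of the boxes $A_1,\dots,A_m$). Then the probability that all boxes can be unlocked starting from the key to $A_1$ is $1/m$.
   Context: All boxes are initially locked, and each key opens only its own box. The player opens $A_1$ and takes all keys in it; then, as long as the player holds a key to a box that is still locked, the player opens such a box and takes all keys in it. All boxes can be unlocked if this process eventually opens every box of both rows; equivalently, the smallest set $O$ of boxes that contains $A_1$ and contains every box whose key lies in a box of $O$ is the set of all $m+n$ boxes. *)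

(* Defs.v *)
From HB Require Import structures.
From mathcomp Require Import all_boot all_order all_algebra.
From mathcomp Require Import all_classical all_reals all_analysis.

Set Implicit Arguments.
Unset Strict Implicit.
Unset Printing Implicit Defensive.

Import Order.TTheory GRing.Theory Num.Theory.
Local Open Scope classical_set_scope.
Local Open Scope ring_scope.

(* Random elements of a finite set V, which carries the discrete
   sigma-algebra: every set of values is measurable. *)

Definition random_element d (T : measurableType d) (V : Type) (X : T -> V) :
    Prop :=
  forall E : set V, measurable (X @^-1` E).

Definition uniform_on d (T : measurableType d) (R : realType)
    (P : probability T R) (V : finType) (S : {set V}) (X : T -> V) : Prop :=
  forall v : V,
    P (X @^-1` [set v]) = (if v \in S then #|S|%:R^-1 else 0)%:E.

(* The product rule holds for every finite subfamily J and every choice of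
   the events {X i \in E i}, i \in J. *)
Definition mutually_independent d (T : measurableType d) (R : realType)
    (P : probability T R) (I : finType) (V : Type) (X : I -> T -> V) : Prop :=
  forall (J : {set I}) (E : I -> set V),
    P (\bigcap_(i in [set` J]) (X i @^-1` E i))
    = (\prod_(i in J) P (X i @^-1` E i))%E.

(* inl i is the box A_(i+1) and inr j is the box B_(j+1). *)
Notation box m n := ('I_m + 'I_n)%type.

Definition in_row_A m n (b : box m n) : bool :=
  if b is inl _ then true else false.

Definition opposite_row m n (b : box m n) : {set box m n} :=
  [set c | in_row_A c != in_row_A b]%SET.

Definition boxA1 m n (hm : (0 < m)%N) : box m n := inl (Ordinal hm).

(* A key is named by the box it opens; the key to A_1 is kept in hand, so it
   is not one of the keys that are placed. *)
Definition placed_key m n (hm : (0 < m)%N) : finType :=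
  {b : box m n | b != boxA1 n hm}.

Section Unlocking.
Variables (m n : nat) (hm : (0 < m)%N).
(* f k is the box in which the key k lies. *)
Variable f : placed_key n hm -> box m n.

Definition key_closed (O : set (box m n)) : Prop :=
  forall k : placed_key n hm, O (f k) -> O (val k).

Definition opened : set (box m n) := smallest key_closed [set boxA1 n hm].

Definition all_unlocked : Prop := opened = [set: box m n].

End Unlocking.

(* Main.v *)
Require Import Defs.
From mathcomp Require Import all_boot all_order all_algebra.
From mathcomp Require Import all_classical all_reals all_analysis.

Set Implicit Arguments.
Unset Strict Implicit.
Unset Printing Implicit Defensive.

Import Order.TTheory GRing.Theory Num.Theory.

(** The boxes are opened in waves.  At any moment let S be the boxes opened in
    the last wave, all in one row; let x be the number of boxes of that row
    that are still locked and y the number of locked boxes of the other row.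
    All that is known about a key that has not been found is that it does not
    lie in a box opened in an earlier wave, so the y keys to the other row are
    independent and uniform on the |S| + x boxes of the row of S that are not
    yet excluded.  Hence the expected number of boxes opened in the next wave
    is y * |S| / (|S| + x).  In the next wave the rows exchange their roles:
    if t boxes are then opened, the fraction |S| / (|S| + x) is replaced by
    t / y, whose expectation is again |S| / (|S| + x).  This fraction is
    therefore a martingale.  It ends at 1 if every box gets opened and at 0 if
    the process gets stuck, so from any state the probability of success is
    |S| / (|S| + x); at the start |S| = 1 and x = m - 1, which gives 1 / m.

    The argument is carried out by counting.  What is known about the keys is
    a family F of sets, F k being the boxes in which the key k may still lie,
    and the possible placements are the functions in the product of the F k.
    Learning which keys lie in S splits this product into smaller products of
    the same kind (family_narrow, unexplored_narrow), so placements never have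
    to be cut into pieces.  The martingale identity is card_all_opened, by
    induction on the number of locked boxes; the uniform behaviour of a single
    key is card_family_at.  Finally uniform_independent_event turns
    probabilities into such counts. *)

(** * Counting in a product of finite sets *)

(** In a uniformly chosen function of the product, each coordinate is uniform
    on its factor; the denominators are cleared so that empty factors need no
    separate treatment. *)
Lemma card_family_at (I V : finType) (F : I -> {set V}) (A : {set V}) (k : I) :
  #|F k| * #|[set f in family F | f k \in A]|
  = #|F k :&: A| * #|family F|.
Proof.
have cardE (G : I -> {set V}) : #|family G| = \prod_i #|G i|.
  by rewrite card_family foldrE big_map big_enum.
pose G i := if i == k then F k :&: A else F i.
have -> : #|[set f in family F | f k \in A]| = #|family G|.
  apply: eq_card => f; rewrite !inE; apply/andP/familyP.
    move=> [/familyP fF fA] i; rewrite /G; case: eqP => [->|_]; last exact: fF.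
    by rewrite inE fA; move: (fF k) => ->.
  move=> fG; split; last by move: (fG k); rewrite /G eqxx inE => /andP[].
  apply/familyP => i; move: (fG i); rewrite /G; case: eqP => [->|//].
  by rewrite inE => /andP[].
rewrite !cardE (bigD1 k) //= [in RHS](bigD1 k) //= {1}/G eqxx.
rewrite (eq_bigr (fun i => #|F i|)) => [|i /negPf ik]; last by rewrite /G ik.
by rewrite mulnCA.
Qed.

(** * Exploration in waves *)

Section Exploration.
Import mathcomp.boot.fintype mathcomp.boot.finset.
Variables (I V : finType) (box_of : I -> V) (row : V -> bool).
Hypothesis box_of_inj : injective box_of.
Implicit Types (U T : {set I}) (S O : {set V}) (F : I -> {set V})
  (f : {ffun I -> V}).

(** The boxes named by U get opened from those of S, said through closed sets
    so that neither paths nor a number of rounds has to be mentioned. *)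
Definition all_opened U S f : bool :=
  [forall O : {set V}, (S \subset O) ==>
     [forall k in U, (f k \in O) ==> (box_of k \in O)] ==>
     (box_of @: U \subset O)].

Lemma all_openedP U S f :
  reflect (forall O, S \subset O ->
             (forall k, k \in U -> f k \in O -> box_of k \in O) ->
             forall k, k \in U -> box_of k \in O)
          (all_opened U S f).
Proof.
apply: (iffP forallP) => [H O SO cl k kU | H O].
  move: (H O); rewrite SO /=.
  have -> : [forall k in U, (f k \in O) ==> (box_of k \in O)].
    by apply/forall_inP => i iU; apply/implyP; apply: cl.
  by move=> /= /subsetP; apply; exact: imset_f.
apply/implyP => SO; apply/implyP => /forall_inP cl.
apply/subsetP => _ /imsetP[k kU ->]; apply: H => // i iU.
exact/implyP/cl.
Qed.

Lemma all_opened_none U f : U != set0 -> all_opened U set0 f = false.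
Proof.
move=> /set0Pn[k kU]; apply/negP => /all_openedP /(_ set0 (sub0set _)) H.
have : box_of k \in (set0 : {set V}) by apply: H kU => i _; rewrite inE.
by rewrite inE.
Qed.

Lemma all_opened_empty S f : all_opened set0 S f.
Proof. by apply/all_openedP => O _ _ k; rewrite inE. Qed.

Definition next_keys U S f : {set I} := [set k in U | f k \in S].

(** One wave of the process: once the keys lying in S have been used, the boxes
    of S are of no further help, because every key they contain is already
    taken. *)
Lemma all_opened_next U S f :
  {in U, forall k, box_of k \notin S} ->
  all_opened U S f =
  all_opened (U :\: next_keys U S f) (box_of @: next_keys U S f) f.
Proof.
move=> US; set T := next_keys U S f.
apply/all_openedP/all_openedP => H O.
  move=> /subsetP TO cl k; rewrite inE => /andP[_ kU].
  have : box_of k \in O :|: S.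
    apply: H kU; first exact: subsetUr.
    move=> i iU; rewrite !inE => fi.
    have [iT|iT] := boolP (i \in T); first by rewrite TO ?imset_f.
    rewrite cl ?in_setD ?iT //; case/orP: fi => // fS.
    by rewrite /T inE iU fS in iT.
  by rewrite inE (negPf (US k kU)) orbF.
move=> /subsetP SO cl k kU.
have TO i : i \in T -> box_of i \in O.
  by rewrite inE => /andP[iU /SO]; apply: cl.
have [/TO //|kT] := boolP (k \in T).
apply: H; last by rewrite in_setD kT.
  by apply/subsetP => _ /imsetP[i iT ->]; apply: TO.
by move=> i; rewrite in_setD => /andP[_ iU]; apply: cl.
Qed.

(** The state of knowledge between two waves: a key in U may lie in any box of
    the row opposite to its own that is locked or was opened in the last
    wave. *)
Definition unexplored U S (F : I -> {set V}) : Prop :=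
  {in U, forall k, F k =
     [set v | (row v != row (box_of k)) && (v \in S :|: box_of @: U)]}.

(** What remains possible for the key k once it is known that T is the set of
    keys in U that lie in S. *)
Definition narrow U S (F : I -> {set V}) T (k : I) : {set V} :=
  if k \in T then F k :&: S else if k \in U then F k :\: S else F k.

(** The outcomes of a wave partition a product of sets into products of sets;
    this is where independence of the keys enters. *)
Lemma family_narrow U S F T f : T \subset U ->
  (f \in family (narrow U S F T)) =
  (f \in family F) && (next_keys U S f == T).
Proof.
move=> /subsetP TU; apply/familyP/andP => [fR|[/familyP fF /eqP <-] k].
  split.
    apply/familyP => k; move: (fR k); rewrite /narrow.
    by case: ifP => _; [|case: ifP => _ //]; rewrite !inE => /andP[].
  apply/eqP/setP => k; move: (fR k); rewrite inE /narrow.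
  case: ifPn => [kT|kT]; first by rewrite inE (TU k kT) => /andP[_ ->].
  by case: ifP => //= _; rewrite inE => /andP[/negPf ->].
rewrite /narrow inE; have := fF k.
by case: (k \in U); case fS: (f k \in S); rewrite /= ?inE ?fS // => ->.
Qed.

(** The state of knowledge is reproduced after a wave: for a key that was not
    found the boxes of S are excluded, and those of the new wave are among the
    boxes that were locked before. *)
Lemma unexplored_narrow U S F T :
  {in U, forall k, box_of k \notin S} -> T \subset U -> unexplored U S F ->
  unexplored (U :\: T) (box_of @: T) (narrow U S F T).
Proof.
move=> US TU FU k; rewrite inE => /andP[kT kU].
rewrite /narrow (negPf kT) kU FU //; apply/setP => v.
have -> : box_of @: T :|: box_of @: (U :\: T) = box_of @: U.
  by rewrite -imsetU -{1}(setIidPr TU) setID.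
rewrite !inE andbCA; congr andb.
have [vS|_] //= := boolP (v \in S).
by apply/esym/negbTE/imsetP => -[i iU vi]; move: (US i iU); rewrite -vi vS.
Qed.

(** Linearity of expectation for the size of the next wave. *)
Lemma sum_card_next_keys U S F :
  \sum_(f in family F) #|next_keys U S f|
  = \sum_(k in U) #|[set f in family F | f k \in S]|.
Proof.
under eq_bigr => f _ do rewrite -sum1_card big_mkcond /=.
rewrite exchange_big /= [RHS]big_mkcond; apply: eq_bigr => k _.
case: ifPn => kU; last by rewrite big1 // => f _; rewrite inE (negPf kU).
rewrite -sum1_card -big_mkcondr /=; apply: eq_bigl => f.
by rewrite !inE kU.
Qed.

(** Success has probability |S| / (|S| + x), where x is the number of locked
    boxes in the row of S.  By induction, given that the next wave is T, the
    probability is |T| / y, because all y locked boxes of the other row are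
    then either in the new wave or still locked.  Averaging over T leaves the
    expected size of the next wave, which is y * |S| / (|S| + x). *)
Lemma card_all_opened (c : bool) U S F :
  {in S, forall v, row v = c} ->
  {in U, forall k, box_of k \notin S} ->
  unexplored U S F ->
  (#|S| + #|[set k in U | row (box_of k) == c]|)
    * #|[set f in family F | all_opened U S f]|
  = #|S| * #|family F|.
Proof.
have none (F' : I -> {set V}) U' : U' != set0 ->
    #|[set f in family F' | all_opened U' set0 f]| = 0.
  move=> U0; apply: eq_card0 => f.
  by rewrite inE all_opened_none ?andbF.
have [N] := ubnP #|U|; elim: N => // N IH in c U S F *.
move=> UN Sc US FU.
have [U0|U0] := eqVneq U set0.
  rewrite U0 (_ : [set k in set0 | _] = set0) ?cards0 ?addn0; last first.
    by apply/setP => k; rewrite !inE.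
  congr (_ * _); apply: eq_card => f.
  by rewrite inE all_opened_empty andbT.
have [->|S0] := eqVneq S set0; first by rewrite none // cards0 muln0.
pose Y := [set k in U | row (box_of k) != c].
have YU : Y \subset U by apply/subsetP => k; rewrite inE => /andP[].
(* If the row opposite to S is fully opened while a box of the row of S is
   locked, the key to that box has no possible place left. *)
have [Y0|Y0] := posnP #|Y|.
  have F0 : #|family F| = 0.
    apply: eq_card0 => f; apply/negP => /familyP fF.
    have [k kU] := set0Pn _ U0; move: (fF k); rewrite FU //.
    have row_c i : i \in U -> row (box_of i) = c.
      move=> iU; apply/eqP; move/eqP: Y0; rewrite cards_eq0 => /eqP/setP/(_ i).
      by rewrite !inE iU /= => /negbFE.
    rewrite !inE row_c // => /andP[/eqP fc /orP[/Sc//|/imsetP[i iU fi]]].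
    by apply: fc; rewrite fi row_c.
  rewrite F0 muln0; apply/eqP; rewrite muln_eq0; apply/orP; right.
  rewrite -leqn0 -F0; apply: subset_leq_card; apply/subsetP => f.
  by rewrite inE => /andP[].
have next_Y f : f \in family F -> next_keys U S f \subset Y.
  move=> /familyP fF; apply/subsetP => k; rewrite !inE => /andP[kU fS].
  rewrite kU /=; move: (fF k); rewrite FU // !inE (Sc _ fS) => /andP[+ _].
  by rewrite eq_sym.
have step T : T \subset Y ->
    #|Y| * #|[set f in family F | (next_keys U S f == T) && all_opened U S f]|
    = #|T| * #|[set f in family F | next_keys U S f == T]|.
  move=> TY; have TU := subset_trans TY YU.
  have -> : #|[set f in family F | next_keys U S f == T]|
            = #|family (narrow U S F T)|.
    by apply: eq_card => f; rewrite in_set family_narrow.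
  have -> : [set f in family F | (next_keys U S f == T) && all_opened U S f]
      = [set f in family (narrow U S F T)
           | all_opened (U :\: T) (box_of @: T) f].
    apply/setP => f; rewrite !in_set family_narrow // andbA.
    by case: eqP => [<-|]; rewrite ?andbF // -all_opened_next.
  (* An empty wave leaves U unchanged, out of reach of the induction. *)
  have [T0|T0] := eqVneq T set0.
    by rewrite T0 imset0 setD0 none // cards0 muln0 mul0n.
  have -> : #|Y| = #|box_of @: T|
       + #|[set k in U :\: T | row (box_of k) == ~~ c]|.
    rewrite card_imset // -(cardsID T Y) (setIidPr TY); congr addn.
    apply: eq_card => k; rewrite !inE andbA; congr andb.
    by case: (row _); case: c {Sc Y YU Y0 next_Y TY}.
  rewrite -[in RHS](card_imset _ box_of_inj); apply: IH.
  - apply: leq_trans (_ : #|U| <= N); last by rewrite -ltnS.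
    apply: proper_card; rewrite properEneq subsetDl andbT.
    apply: contra T0 => /eqP /setDidPl UT; rewrite -subset0.
    by move: UT; rewrite disjoint_sym -setI_eq0 (setIidPl TU) => /eqP ->.
  - move=> _ /imsetP[k kT ->]; move: (subsetP TY k kT); rewrite inE.
    by case/andP => _; case: (row _); case: c {Sc Y YU Y0 next_Y TY}.
  - move=> k; rewrite inE => /andP[kT _].
    by rewrite mem_imset.
  - exact: unexplored_narrow.
(* The conditional probabilities |T| / #|Y|, averaged over the waves T. *)
have good_sum : #|Y| * #|[set f in family F | all_opened U S f]|
    = \sum_(k in U) #|[set f in family F | f k \in S]|.
  rewrite -sum_card_next_keys -[X in _ * X]sum1_card.
  rewrite (partition_big (next_keys U S) (fun T => T \subset Y)) /=; last first.
    by move=> f; rewrite in_set => /andP[/next_Y].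
  rewrite big_distrr /=.
  rewrite [RHS](partition_big (next_keys U S) (fun T => T \subset Y)) //=.
  apply: eq_bigr => T /step E.
  rewrite sum1dep_card (_ : [set f | _ & _] = [set f in family F |
    (next_keys U S f == T) && all_opened U S f]); last first.
    by apply/setP => f; rewrite !inE -andbA; congr andb; rewrite andbC.
  rewrite E mulnC -sum_nat_const; apply: eq_big => [f|f]; first by rewrite inE.
  by rewrite inE => /andP[_ /eqP ->].
apply/eqP; rewrite -(eqn_pmul2l Y0) mulnCA good_sum; apply/eqP.
rewrite -sum_nat_const big_distrr /= (bigID (mem Y)) /=.
rewrite [X in _ + X]big1 => [|k /andP[kU kY]]; last first.
  rewrite [X in _ * X]eq_card0 ?muln0 // => f; apply/negbTE; rewrite in_set.
  apply: contra kY => /andP[/next_Y /subsetP fY fS].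
  by apply: fY; rewrite inE kU.
rewrite addn0; apply: eq_big => [k|k /andP[kU kY]].
  by rewrite andb_idl // => /(subsetP YU).
have rowk : row (box_of k) = ~~ c.
  by move: kY; rewrite inE kU; case: (row _); case: (c).
have Fk : F k = S :|: box_of @: [set k in U | row (box_of k) == c].
  apply/setP => v; rewrite FU // !inE rowk.
  have [/Sc ->|vS] /= := boolP (v \in S); first by case: (c).
  apply/andP/imsetP => [[rv /imsetP[i iU vi]]|[i + ->]].
    exists i => //; rewrite inE iU -vi; by move: rv; case: (row v); case: (c).
  by rewrite inE => /andP[iU /eqP ->]; rewrite imset_f //; case: (c).
have -> : #|S| + #|[set k in U | row (box_of k) == c]| = #|F k|.
  rewrite -(card_imset (mem [set k in U | row (box_of k) == c]) box_of_inj).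
  rewrite Fk cardsU.
  rewrite (_ : S :&: _ = set0) ?cards0 ?subn0 //.
  apply/setP => v; rewrite !inE; apply/andP => -[vS /imsetP[i iU vi]].
  by move: iU; rewrite inE => /andP[/US]; rewrite -vi vS.
by rewrite card_family_at Fk setUK.
Qed.
End Exploration.

(** * Independent uniform random elements of finite sets *)

Local Open Scope classical_set_scope.
Local Open Scope ring_scope.

Lemma probability_finite_family (R : realType) (d : measure_display)
    (T : measurableType d) (P : probability T R) (I V : finType)
    (X : I -> T -> V) (Q : pred {ffun I -> V}) :
  (forall i, random_element (X i)) -> mutually_independent P X ->
  P [set w | Q [ffun i => X i w]]
  = (\sum_(f | Q f) \prod_i P (X i @^-1` [set f i]))%E.
Proof.
move=> rX indX.
pose A (f : {ffun I -> V}) :=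
  \bigcap_(i in [set` [set: I]%SET]) (X i @^-1` [set f i]).
have AP f w : A f w <-> [ffun i => X i w] = f.
  split=> [Af|<- i _ /=]; last by rewrite ffunE.
  by apply/ffunP => i; rewrite ffunE; apply: Af; rewrite /= finset.in_setT.
have -> : [set w | Q [ffun i => X i w]] = \bigcup_(f in [set` Q]) A f.
  apply/seteqP; split=> w /=.
    by move=> Qw; exists [ffun i => X i w]; rewrite ?AP.
  by move=> [f Qf /AP ->].
rewrite measure_fin_bigcup //.
- rewrite -(bigfs _ (index_enum_uniq _)) => [|f _]; last first.
    by rewrite mem_index_enum.
  apply: eq_bigr => f _; apply: etrans (indX _ (fun i => [set f i])) _.
  by apply: eq_bigl => i; rewrite finset.in_setT.
- by move=> f g _ _ [w [/AP <- /AP <-]].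
- move=> f _; apply: fin_bigcap_measurable => // i _; exact: rX.
Qed.

Lemma uniform_independent_event (R : realType) (d : measure_display)
    (T : measurableType d) (P : probability T R) (I V : finType)
    (F : I -> {set V}) (X : I -> T -> V) (Q : pred {ffun I -> V}) :
  (forall i, random_element (X i)) -> (forall i, uniform_on P (F i) (X i)) ->
  mutually_independent P X ->
  P [set w | Q [ffun i => X i w]]
  = (#|[set f in family F | Q f]%SET|%:R / #|family F|%:R)%:E.
Proof.
move=> rX uX indX; rewrite probability_finite_family //.
have prodE (f : {ffun I -> V}) : (\prod_i P (X i @^-1` [set f i]))%E
    = (if f \in family F then #|family F|%:R^-1 else 0)%:E.
  under eq_bigr => i _ do rewrite uX.
  rewrite prodEFin; congr EFin; case: ifPn => [/familyP fF|].
    rewrite card_family foldrE big_map big_enum natr_prod.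
    rewrite (big_morph _ (@invfM R) (@invr1 R)).
    by apply: eq_bigr => i _; rewrite fF.
  move=> /familyP; rewrite -existsNE => -[i fi].
  by rewrite (bigD1 i) //= (negPf (introN idP fi)) mul0r.
under eq_bigr => f _ do rewrite prodE.
rewrite sumEFin -big_mkcondr /= sumr_const mulr_natl; congr (_ *+ _)%:E.
by apply: eq_card => f; rewrite !inE andbC.
Qed.

(** * The two rows of boxes *)

Section Boxes.
Variables (m n : nat) (hm : (0 < m)%N).
Notation A1 := (boxA1 n hm).

(** The box A_1 belongs to every closed set considered, and any other box is
    named by its key; hence the smallest closed set is everything as soon as
    every closed set contains all boxes whose key was placed. *)
Lemma all_unlockedP (f : {ffun placed_key n hm -> box m n}) :
  reflect (all_unlocked f)
    (all_opened val [set: placed_key n hm]%SET [set A1]%SET f).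
Proof.
apply: (iffP (all_openedP _ _ _ _)) => [H | H O].
  apply/seteqP; split=> // b _ S [/= clS A1S].
  pose O := [set x | `[< S x >]]%SET.
  have [-> | bA1] := eqVneq b A1; first exact: A1S.
  have : val (Sub b bA1 : placed_key n hm) \in O.
    apply: H; rewrite ?inE //.
      by rewrite finset.sub1set !inE; apply: A1S.
    by move=> k _; rewrite !inE; apply: clS.
  by rewrite !inE.
rewrite finset.sub1set => A1O cl k _.
have : opened f `<=` [set` O].
  move=> x; apply; split=> [i /= Oi|x' ->//].
  by apply: cl; rewrite ?inE.
by rewrite H; apply.
Qed.

Lemma card_row_A : #|[set b : box m n | in_row_A b]%SET| = m.
Proof.
rewrite -[RHS]card_ord -(card_imset (mem 'I_m) (@inl_inj _ 'I_n)).
apply: eq_card => b; rewrite inE; apply/idP/imsetP => [|[i _ ->]] //.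
by case: b => // i _; exists i.
Qed.

(** The initial state: A_1 is the only wave so far, and the row A contains m
    boxes in all, opened or locked. *)
Lemma card_all_unlocked :
  (m * #|[set f in family (fun k : placed_key n hm => opposite_row (val k))
      | all_opened val [set: _] [set A1] f]%SET|)%N
  = #|family (fun k : placed_key n hm => opposite_row (val k))|.
Proof.
rewrite -[RHS]mul1n -[in RHS](finset.cards1 A1).
rewrite -(card_all_opened (row := @in_row_A m n) (c := true)
  (U := [set: placed_key n hm]%SET) val_inj) //.
- congr (_ * _)%N; rewrite -[LHS]card_row_A (cardsD1 A1) inE finset.cards1.
  congr addn; rewrite -[RHS](card_imset _ val_inj); apply: eq_card => b.
  apply/idP/imsetP => [|[k + ->]].
    by rewrite !inE => /andP[bA1 bA]; exists (Sub b bA1); rewrite // !inE /= bA.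
  by rewrite !inE (valP k) => /eqP ->.
- by move=> v; rewrite inE => /eqP ->.
- by move=> k _; rewrite inE (valP k).
- move=> k _; apply/setP => v; rewrite !inE.
  have [_|vA1] /= := eqVneq v A1; first by rewrite andbT.
  have -> : v \in [set val x | x in [set: placed_key n hm]]%SET.
    by apply/imsetP; exists (Sub v vA1).
  by rewrite andbT.
Qed.

End Boxes.

Theorem theorem10 (R : realType) (d : measure_display) (T : measurableType d)
    (P : probability T R) (m n : nat) (hm : (0 < m)%N) (hn : (0 < n)%N)
    (K : placed_key n hm -> T -> box m n)
    (K_random : forall k : placed_key n hm, random_element (K k))
    (K_uniform : forall k : placed_key n hm,
       uniform_on P (opposite_row (val k)) (K k))
    (K_independent : mutually_independent P K) :
  P [set w | all_unlocked (fun k : placed_key n hm => K k w)]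
  = (m%:R^-1 : R)%:E.
Proof.
pose Q (f : {ffun placed_key n hm -> box m n}) :=
  all_opened val [set: placed_key n hm]%SET [set boxA1 n hm]%SET f.
have -> : [set w | all_unlocked (fun k => K k w)]
    = [set w | Q [ffun k => K k w]].
  have KE w : all_unlocked (fun k => K k w) = all_unlocked [ffun k => K k w].
    by congr all_unlocked; apply/funext => k; rewrite ffunE.
  by apply/seteqP; split=> w; rewrite /= KE => /all_unlockedP.
rewrite (uniform_independent_event _ K_random K_uniform K_independent).
have : (0 < #|family (fun k : placed_key n hm => opposite_row (val k))|)%N.
  apply/card_gt0P; exists [ffun k : placed_key n hm =>
    if in_row_A (val k) then inr (Ordinal hn) else boxA1 n hm].
  by apply/familyP => k; rewrite ffunE inE; case: (val k).
rewrite -card_all_unlocked muln_gt0 => /andP[_ good_gt0].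
by rewrite natrM invfM mulrC mulfVK // pnatr_eq0 -lt0n.
Qed.
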